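(* Let $A, B$ be $n\times n$ positive definite complex matrices. Then for $t\in(0,1)$, $$A\natural_t B\le_\lambda A\diamond_t B,$$ where the equality (that is, $\lambda_i(A\natural_t B)=\lambda_i(A\diamond_t B)$ for all $i$) holds if and only if $A=B$.
   Context: Positive definite means Hermitian positive definite. For positive definite $A,B$: $A\sharp B = A^{1/2}(A^{-1/2}BA^{-1/2})^{1/2}A^{1/2}$. For $t\in[0,1]$, the spectral geometric mean is $A\natural_t B=(A^{-1}\sharp B)^tA(A^{-1}\sharp B)^t$, and the Wasserstein mean is $A\diamond_t B=(1-t)^2A+t^2B+t(1-t)[(AB)^{1/2}+(BA)^{1/2}]$, where the square roots are those with positive eigenvalues; equivalently $A\diamond_tB=[(1-t)I+t(A^{-1}\sharp B)]A[(1-t)I+t(A^{-1}\sharp B)]$. For positive definite $X$, $\lambda_1(X)\ge\cdots\ge\lambda_n(X)$ are its eigenvalues in nonincreasing order; $X\le_\lambda Y$ means $\lambda_i(X)\le\lambda_i(Y)$ for all $1\le i\le n$. *)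

(* Defs.v *)
From mathcomp Require Import all_boot all_order all_algebra.
From mathcomp Require Import sesquilinear spectral.
From mathcomp Require Import complex.
From mathcomp Require Import boolp classical_sets reals exp.

Set Implicit Arguments.
Unset Strict Implicit.
Unset Printing Implicit Defensive.

Import Order.TTheory GRing.Theory Num.Theory.
Local Open Scope ring_scope.
Local Open Scope complex_scope.
Local Open Scope sesquilinear_scope.

(* On R[i], [0 < z] holds iff z is real and positive. *)
Definition posdefmx (R : realType) (n : nat) (A : 'M[R[i]]_n) : Prop :=
  A \is hermsymmx /\
  forall x : 'cV[R[i]]_n, x != 0 -> 0 < (x ^t* *m A *m x) 0 0.

(* Real powers by functional calculus on the spectral decomposition
   A = P^-1 *m diag_mx d *m P, with P unitary; meaningful for A positive
   definite (for other matrices the value is irrelevant). *)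
Definition mxpowR (R : realType) (n : nat) (A : 'M[R[i]]_n) (s : R) :
    'M[R[i]]_n :=
  invmx (spectralmx A)
  *m diag_mx (map_mx (fun z : R[i] => (powR (complex.Re z) s)%:C)
                     (spectral_diag A))
  *m spectralmx A.

Definition geomean (R : realType) (n : nat) (A B : 'M[R[i]]_n) : 'M[R[i]]_n :=
  let Ah := mxpowR A (2^-1) in
  let Anh := mxpowR A (- 2^-1) in
  Ah *m mxpowR (Anh *m B *m Anh) (2^-1) *m Ah.

Definition specgeomean (R : realType) (n : nat) (t : R) (A B : 'M[R[i]]_n) :
    'M[R[i]]_n :=
  let X := mxpowR (geomean (invmx A) B) t in X *m A *m X.

(* The square root with positive eigenvalues of a matrix which need not be
   Hermitian; it exists and is unique when M is diagonalizable with positive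
   eigenvalues, as is the product of two positive definite matrices. *)
Definition possqrtmx (R : realType) (n : nat) (M : 'M[R[i]]_n) : 'M[R[i]]_n :=
  xget 0 [set X : 'M[R[i]]_n |
    X *m X = M /\ forall a : R[i], eigenvalue X a -> 0 < a]%classic.

Definition wassersteinmean (R : realType) (n : nat) (t : R)
    (A B : 'M[R[i]]_n) : 'M[R[i]]_n :=
  ((1 - t) ^+ 2)%:C *: A + (t ^+ 2)%:C *: B
  + (t * (1 - t))%:C *: (possqrtmx (A *m B) + possqrtmx (B *m A)).

(* The roots of the characteristic polynomial, with multiplicity. *)
Definition eigenvalues (R : realType) (n : nat) (X : 'M[R[i]]_n) : seq R[i] :=
  sval (closed_field_poly_normal (char_poly X)).

(* The eigenvalues of X in nonincreasing order, indexed from 0, read as real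
   numbers (for X positive definite they are real). *)
Definition lambda (R : realType) (n : nat) (X : 'M[R[i]]_n) (i : 'I_n) : R :=
  nth 0 (sort (fun x y : R => y <= x)
              [seq complex.Re z | z <- eigenvalues X]) i.

Definition le_lambda (R : realType) (n : nat) (X Y : 'M[R[i]]_n) : Prop :=
  forall i : 'I_n, lambda X i <= lambda Y i.

(* Main.v *)
(* Let G be the geometric mean of A^-1 and B, the positive definite solution of
   the Riccati equation G A G = B. The two means are X A X and Y A Y, with
   X = G^t and Y = (1 - t) I + t G simultaneously diagonalizable and X <= Y by
   weighted AM-GM. With A = S^2, these are similar to S X^2 S <= S Y^2 S, so the
   inequality is Weyl monotonicity. If all eigenvalues agree, so do the traces,
   which forces X^2 = Y^2; strictness of AM-GM then gives G = I, i.e. A = B. *)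
Require Import Defs.
From mathcomp Require Import all_boot all_order all_algebra.
From mathcomp Require Import complex reals.
From mathcomp Require Import sesquilinear spectral boolp classical_sets exp.
From mathcomp Require Import lra.

Set Implicit Arguments.
Unset Strict Implicit.
Unset Printing Implicit Defensive.

Import Order.TTheory GRing.Theory Num.Theory.
Local Open Scope ring_scope.
Local Open Scope complex_scope.
Local Open Scope sesquilinear_scope.

(** * Similarity invariance of the characteristic polynomial *)

Lemma char_poly_conj (F : fieldType) (n : nat) (P A : 'M[F]_n) :
  P \in unitmx -> char_poly (P *m A *m invmx P) = char_poly A.
Proof.
move=> uP; have PV : map_mx polyC P *m map_mx polyC (invmx P) = 1%:M.
  by rewrite -map_mxM mulmxV// map_mx1.
rewrite /char_poly /char_poly_mx.
have -> : 'X%:M - map_mx polyC (P *m A *m invmx P) =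
    map_mx polyC P *m ('X%:M - map_mx polyC A) *m map_mx polyC (invmx P).
  by rewrite mulmxBr mulmxBl !map_mxM scalar_mxC -(mulmxA 'X%:M) PV mulmx1.
by rewrite !det_mulmx mulrAC -det_mulmx PV det1 mul1r.
Qed.

(** [A *m B] is the conjugate of [B *m A] by [A]. With [X *m S] and [S *m X] as factors, this passes
    from [X (S S) X] to [S (X X) S]. *)
Lemma char_poly_mulmxC (F : fieldType) (n : nat) (A B : 'M[F]_n) :
  A \in unitmx -> char_poly (A *m B) = char_poly (B *m A).
Proof. by move=> uA; rewrite -(char_poly_conj (B *m A) uA) mulmxA mulmxK. Qed.

(** * Comparing sorted sequences by threshold counts *)

Section Seq.
Variable R : realDomainType.

(** In a nonincreasing sequence the entries reaching [c] form an initial segment, so index [i] lies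
    in it exactly when its length exceeds [i]. *)
Lemma count_geS_nth (s : seq R) (c : R) (i : nat) :
  sorted >=%R s -> (i < size s)%N ->
  (i < count (fun y => (c <= y)%R) s)%N = (c <= nth 0 s i).
Proof.
elim: s i => [|x s IHs] // i s_sorted si.
have small : x < c -> {in s, forall y, y < c}.
  move=> xc y ys; apply: le_lt_trans xc.
  have/allP/(_ _ ys)// : all (>=%R x) s.
  by apply: order_path_min s_sorted => u v w uv vw; exact: le_trans vw uv.
case: i si => [|i] /= si; case: (leP c x) => // xc; rewrite ?add0n ?add1n ?ltnS.
- rewrite -has_count; apply/hasPn => y /(small xc).
  by rewrite ltNge.
- exact: IHs (path_sorted s_sorted) _.
- rewrite [RHS]leNgt small ?mem_nth//=; apply/negbTE; rewrite -leqNgt.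
  apply: leq_trans (leq0n _); rewrite leqNgt -has_count; apply/hasPn => y /(small xc).
  by rewrite ltNge.
Qed.

(** Take for [c] the [i]-th largest entry of [s1]: more than [i] entries of [s1] reach it, hence
    more than [i] entries of [s2] do. *)
Lemma nth_sort_ge_le (s1 s2 : seq R) (i : nat) :
  size s1 = size s2 -> (i < size s1)%N ->
  (forall c, (count (fun y => (c <= y)%R) s1 <= count (fun y => (c <= y)%R) s2)%N) ->
  nth 0 (sort >=%R s1) i <= nth 0 (sort >=%R s2) i.
Proof.
move=> eqs si le12.
have st s : sorted >=%R (sort (>=%R : rel R) s).
  by apply: sort_sorted => x y; exact: le_total.
rewrite -count_geS_nth ?st ?size_sort -?eqs// (permP (permEl (perm_sort _ _))).
apply: leq_trans (le12 _).
by rewrite -(permP (permEl (perm_sort (>=%R : rel R) s1))) count_geS_nth ?st ?size_sort.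
Qed.

End Seq.

(** * Quadratic forms and unitary diagonalization *)

Section Hermitian.
Variables (C : numClosedFieldType) (n : nat).
Implicit Types (A B G K M U V X Y Z P : 'M[C]_n) (e f : 'I_n -> C) (x : 'cV[C]_n).

Definition qform A x : C := (x^t* *m A *m x) 0 0.

(** [posdefmx] over an arbitrary closed numeric field; over [R[i]] the two are convertible. *)
Definition pdmx A := A \is hermsymmx /\ forall x, x != 0 -> 0 < qform A x.

(** For fixed [U] these matrices form a commuting algebra, on which sums, products and order reduce
    to entrywise operations on [e]. *)
Definition udiagmx U e : 'M[C]_n := U^t* *m diag_mx (\row_j e j) *m U.

Definition mxfun (g : C -> C) A : 'M[C]_n :=
  invmx (spectralmx A) *m diag_mx (map_mx g (spectral_diag A)) *m spectralmx A.

Lemma trC_mul p q r (A : 'M[C]_(p, q)) (B : 'M[C]_(q, r)) :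
  (A *m B)^t* = B^t* *m A^t*.
Proof. by rewrite trmx_mul map_mxM. Qed.

Lemma hermsymmxE A : (A \is hermsymmx) <-> A^t* = A.
Proof.
split=> [/is_hermitianmxP|h]; first by rewrite expr0 scale1r => {2}->.
by apply/is_hermitianmxP; rewrite expr0 scale1r.
Qed.

Lemma mulmx1_invmx A B : A *m B = 1%:M -> invmx A = B.
Proof.
move=> AB; have [uA _] := mulmx1_unit AB.
by rewrite -[B](mulKmx uA) AB mulmx1.
Qed.

Lemma eq_udiagmx U e f : e =1 f -> udiagmx U e = udiagmx U f.
Proof. by move=> /funext ->. Qed.

Lemma udiagmxM U e f : U \is unitarymx ->
  udiagmx U e *m udiagmx U f = udiagmx U (fun j => e j * f j).
Proof.
move=> uU; rewrite /udiagmx -!mulmxA (mulmxA U) (unitarymxP uU) mul1mx.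
rewrite (mulmxA (diag_mx _)) mulmx_diag; congr (_ *m (diag_mx _ *m _)).
by apply/rowP => j; rewrite !mxE.
Qed.

Lemma udiagmx_const U (a : C) : U \is unitarymx -> udiagmx U (fun=> a) = a%:M.
Proof.
move=> uU; rewrite /udiagmx (_ : diag_mx _ = a%:M); last first.
  by apply/matrixP=> i j; rewrite !mxE.
by rewrite scalar_mxC -mulmxA -invmx_unitary// mulVmx ?unitarymx_unit// mulmx1.
Qed.

Lemma udiagmxZ U a e : a *: udiagmx U e = udiagmx U (fun j => a * e j).
Proof.
rewrite /udiagmx scalemxAl scalemxAr -linearZ/=; congr (_ *m diag_mx _ *m _).
by apply/rowP => j; rewrite !mxE.
Qed.

Lemma udiagmxD U e f : udiagmx U e + udiagmx U f = udiagmx U (fun j => e j + f j).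
Proof.
rewrite /udiagmx -mulmxDl -mulmxDr -linearD/=; congr (_ *m diag_mx _ *m _).
by apply/rowP => j; rewrite !mxE.
Qed.

Lemma udiagmxB U e f : udiagmx U e - udiagmx U f = udiagmx U (fun j => e j - f j).
Proof.
rewrite -scaleN1r udiagmxZ udiagmxD.
by apply: eq_udiagmx => j; rewrite mulN1r.
Qed.

Lemma conj_udiagmx U e : U \is unitarymx ->
  U *m udiagmx U e *m U^t* = diag_mx (\row_j e j).
Proof.
by move=> uU; rewrite /udiagmx -!mulmxA (unitarymxP uU) mulmx1 mulmxA (unitarymxP uU) mul1mx.
Qed.

Lemma udiagmx_inj U e f : U \is unitarymx -> udiagmx U e = udiagmx U f -> e =1 f.
Proof.
move=> uU /(congr1 (fun M => U *m M *m U^t*)).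
rewrite !conj_udiagmx// => /matrixP + j => /(_ j j).
by rewrite !mxE eqxx !mulr1n.
Qed.

Lemma udiagmx_herm U e : (forall j, e j \is Num.real) -> udiagmx U e \is hermsymmx.
Proof.
move=> re; apply/hermsymmxE; rewrite /udiagmx !trC_mul trmxCK mulmxA.
congr (_ *m _ *m _); apply/matrixP=> i j; rewrite !mxE eq_sym.
case: eqP => [->|_]; first by rewrite !mulr1n; exact/CrealP.
by rewrite !mulr0n conjC0.
Qed.

(** One [U] serves [A] and all its functions at once, since [mxfun] is built on the same
    [spectralmx A]. *)
Lemma hermitian_udiagmx A : A \is hermsymmx ->
  exists U e, [/\ U \is unitarymx, forall j, e j \is Num.real, A = udiagmx U e &
    forall g, mxfun g A = udiagmx U (g \o e)].
Proof.
move=> hA; exists (spectralmx A), (fun j => spectral_diag A 0 j).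
have uU := spectral_unitarymx A; split=> //.
- by move=> j; exact: (mxOverP (hermitian_spectral_diag_real hA)).
- rewrite {1}(orthomx_spectralP (hermitian_normalmx hA)) invmx_unitary//.
  by congr (_ *m diag_mx _ *m _); apply/rowP => j; rewrite !mxE.
- move=> g; rewrite /mxfun invmx_unitary//.
  by congr (_ *m diag_mx _ *m _); apply/rowP => j; rewrite !mxE.
Qed.

Lemma qform_udiagmx U e x :
  qform (udiagmx U e) x = \sum_j e j * `|(U *m x) j 0| ^+ 2.
Proof.
rewrite /qform /udiagmx !mulmxA -trC_mul -mulmxA; set y := U *m x; rewrite mxE.
by apply: eq_bigr => j _; rewrite mul_mx_diag !mxE normCK mulrAC mulrC (mulrC (_^*)%R).
Qed.

Lemma qformB A B x : qform (A - B) x = qform A x - qform B x.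
Proof. by rewrite /qform mulmxBr mulmxBl !mxE. Qed.

Lemma qform_conj P A x : qform (P^t* *m A *m P) x = qform A (P *m x).
Proof. by rewrite /qform trC_mul !mulmxA. Qed.

Lemma qform_udiagmx_ge0 U e x : (forall j, 0 <= e j) -> 0 <= qform (udiagmx U e) x.
Proof.
move=> e0; rewrite qform_udiagmx sumr_ge0// => j _.
by rewrite mulr_ge0 ?exprn_ge0.
Qed.

(** * Positive definite matrices *)

Lemma unitmx_mulcol_neq0 U x : U \in unitmx -> x != 0 -> U *m x != 0.
Proof. by move=> uU; apply: contraNneq => h; rewrite -(mulKmx uU x) h mulmx0. Qed.

Lemma udiagmx_pd U e : U \is unitarymx -> (forall j, 0 < e j) -> pdmx (udiagmx U e).
Proof.
move=> uU e0; split=> [|x x0].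
  by apply: udiagmx_herm => j; exact/gtr0_real.
rewrite lt_def qform_udiagmx_ge0 ?andbT; last by move=> j; exact: ltW.
apply: contraNneq (unitmx_mulcol_neq0 (unitarymx_unit uU) x0) => h.
apply/eqP/colP => j; rewrite [RHS]mxE; apply/eqP.
have: e j * `|(U *m x) j 0| ^+ 2 == 0.
  apply/eqP; apply: (@psumr_eq0P _ _ predT (fun j => e j * `|(U *m x) j 0| ^+ 2)) => //.
    by move=> k _; rewrite mulr_ge0 ?exprn_ge0// ltW.
  by rewrite -qform_udiagmx.
by rewrite mulf_eq0 expf_eq0/= normr_eq0 gt_eqF.
Qed.

Lemma pd_diag_gt0 A i : pdmx A -> 0 < A i i.
Proof.
move=> [_ /(_ (delta_mx i 0))] pA.
have d0 : (delta_mx i 0 : 'cV[C]_n) != 0.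
  by apply/eqP => /matrixP/(_ i 0)/eqP; rewrite !mxE !eqxx oner_eq0.
have := pA d0; rewrite /qform -mulmxA -colE mxE (bigD1 i)//= big1 => [|j ji].
  by rewrite !mxE !eqxx conjC1 mul1r addr0.
by rewrite !mxE (negbTE ji) conjC0 mul0r.
Qed.

Lemma pd_trC A : pdmx A -> A^t* = A.
Proof. by case=> /hermsymmxE. Qed.

Lemma pd_conj P A : P \in unitmx -> pdmx A -> pdmx (P^t* *m A *m P).
Proof.
move=> uP [/hermsymmxE hA pA]; split=> [|x x0].
  by apply/hermsymmxE; rewrite !trC_mul trmxCK hA mulmxA.
by rewrite qform_conj pA// unitmx_mulcol_neq0.
Qed.

Lemma unitary_trC_unit U : U \is unitarymx -> U^t* \in unitmx.
Proof. by move=> uU; rewrite -invmx_unitary// unitmx_inv unitarymx_unit. Qed.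

(** The eigenvalues are the diagonal entries of [U *m A *m U^t*], which is positive definite by
    congruence. *)
Lemma pd_udiagmx A : pdmx A ->
  exists U e, [/\ U \is unitarymx, forall j, 0 < e j, A = udiagmx U e &
    forall g, mxfun g A = udiagmx U (g \o e)].
Proof.
move=> pA; have [U [e [uU _ eA eg]]] := hermitian_udiagmx (proj1 pA).
exists U, e; split=> // j.
have := pd_diag_gt0 j (pd_conj (unitary_trC_unit uU) pA).
by rewrite trmxCK eA conj_udiagmx// !mxE eqxx.
Qed.

Lemma pd_unit A : pdmx A -> A \in unitmx.
Proof.
move=> /pd_udiagmx[U [e [uU e0 -> _]]].
suff /mulmx1_unit[] : udiagmx U e *m udiagmx U (fun j => (e j)^-1) = 1%:M by [].
rewrite udiagmxM// -[RHS](udiagmx_const 1 uU); apply: eq_udiagmx => j.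
by rewrite divff// gt_eqF.
Qed.

Lemma pd_inv A : pdmx A -> pdmx (invmx A).
Proof.
move=> /pd_udiagmx[U [e [uU e0 -> _]]].
rewrite (@mulmx1_invmx _ (udiagmx U (fun j => (e j)^-1))).
  by apply: udiagmx_pd => // j; rewrite invr_gt0.
rewrite udiagmxM// -[RHS](udiagmx_const 1 uU); apply: eq_udiagmx => j.
by rewrite divff// gt_eqF.
Qed.

Lemma pd_sandwich P A : pdmx P -> pdmx A -> pdmx (P *m A *m P).
Proof.
by move=> pP pA; rewrite -{1}(pd_trC pP); apply: pd_conj => //; exact: pd_unit.
Qed.

Lemma pd_sqrt A : pdmx A -> exists2 S, pdmx S & S *m S = A.
Proof.
move=> /pd_udiagmx[U [e [uU e0 -> _]]].
exists (udiagmx U (fun j => sqrtC (e j))).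
  by apply: udiagmx_pd => // j; rewrite sqrtC_gt0.
by rewrite udiagmxM//; apply: eq_udiagmx => j; rewrite -expr2 sqrtCK.
Qed.

(** * Spectra, positive square roots and the Riccati equation *)

Lemma char_poly_conj_diag P (d : 'rV[C]_n) : P \in unitmx ->
  char_poly (P *m diag_mx d *m invmx P) = \prod_j ('X - (d 0 j)%:P).
Proof.
move=> uP; rewrite char_poly_conj// char_poly_trig ?diag_mx_is_trig//.
by apply: eq_bigr => j _; rewrite mxE eqxx.
Qed.

Lemma char_poly_udiagmx U e : U \is unitarymx ->
  char_poly (udiagmx U e) = \prod_j ('X - (e j)%:P).
Proof.
move=> uU; have uU' := unitary_trC_unit uU.
rewrite /udiagmx -[X in _ *m X]invmxK (invmx_unitary uU) char_poly_conj_diag//.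
by apply: eq_bigr => j _; rewrite mxE.
Qed.

Lemma mxtrace_udiagmx U e : U \is unitarymx -> \tr (udiagmx U e) = \sum_j e j.
Proof.
move=> uU; rewrite /udiagmx mxtrace_mulC mulmxA (unitarymxP uU) mul1mx mxtrace_diag.
by apply: eq_bigr => j _; rewrite mxE.
Qed.

Lemma mxtrace_udiagmxM U e A :
  \tr (udiagmx U e *m A) = \sum_j e j * (U *m A *m U^t*) j j.
Proof.
rewrite /udiagmx -!mulmxA mxtrace_mulC -!mulmxA (mulmxA U) /mxtrace.
by apply: eq_bigr => j _; rewrite mul_diag_mx !mxE.
Qed.

(* With W = X - Z, the equation X W = - W Z makes the columns of W *m P
   eigenvectors of X for the negative values - e j. *)
Lemma possqrt_diag_unique P e X Z : P \in unitmx -> (forall j, 0 < e j) ->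
  Z = P *m diag_mx (\row_j e j) *m invmx P ->
  X *m X = Z *m Z -> (forall a, eigenvalue X a -> 0 < a) -> X = Z.
Proof.
move=> uP e0 eZ XX Xpos; apply/eqP; rewrite -subr_eq0; set W := X - Z.
have XW : X *m W = - (W *m Z).
  by rewrite /W mulmxBr mulmxBl XX opprB.
suff WP : W *m P = 0 by rewrite -(mulmxK uP W) WP mul0mx.
have XWP : X *m (W *m P) = - (W *m P *m diag_mx (\row_j e j)).
  by rewrite mulmxA XW eZ mulNmx !mulmxA mulmxKV.
apply/matrixP => i j; rewrite [RHS]mxE.
have uX : X - (- e j)%:M \in unitmx.
  rewrite -row_free_unit -kermx_eq0; apply/negPn/negP => /(Xpos (- e j)).
  by rewrite oppr_gt0 lt_gtF.
have : (X - (- e j)%:M) *m col j (W *m P) = 0.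
  rewrite mulmxBl mul_scalar_mx scaleNr opprK {1}colE mulmxA -colE XWP.
  by apply/colP => k; rewrite mul_mx_diag !mxE mulrC addNr.
move/(congr1 (mulmx (invmx (X - (- e j)%:M)))); rewrite mulKmx// mulmx0.
by move/colP/(_ i); rewrite !mxE.
Qed.

(** With [A = S *m S], the product equals [S (S G S) S^-1], so it is similar to the positive
    definite matrix [S G S]. *)
Lemma pdM_diag A G : pdmx A -> pdmx G ->
  exists P e, [/\ P \in unitmx, forall j, 0 < e j &
    A *m G = P *m diag_mx (\row_j e j) *m invmx P].
Proof.
move=> pA pG; have [S pS SS] := pd_sqrt pA; have uS := pd_unit pS.
have [U [e [uU e0 eK _]]] := pd_udiagmx (pd_sandwich pS pG).
exists (S *m U^t*), e; split=> //; first by rewrite unitmx_mul uS unitary_trC_unit.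
have -> : invmx (S *m U^t*) = U *m invmx S.
  apply: mulmx1_invmx; rewrite mulmxA -(mulmxA S) -invmx_unitary//.
  by rewrite mulVmx ?unitarymx_unit// mulmx1 mulmxV.
have := congr1 (fun M => S *m M *m invmx S) eK.
by rewrite /udiagmx !mulmxA mulmxK// SS => ->.
Qed.

Lemma pdM_eigenvalue_gt0 A G a : pdmx A -> pdmx G -> eigenvalue (A *m G) a -> 0 < a.
Proof.
move=> pA pG; have [P [e [uP e0 ->]]] := pdM_diag pA pG.
rewrite eigenvalue_root_char char_poly_conj_diag// /root horner_prod prodf_seq_eq0.
by case/hasP => j _; rewrite /= !mxE hornerXsubC subr_eq0 => /eqP->.
Qed.

Lemma possqrt_pdM_unique A G X : pdmx A -> pdmx G ->
  X *m X = A *m G *m (A *m G) -> (forall a, eigenvalue X a -> 0 < a) -> X = A *m G.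
Proof.
move=> pA pG XX Xpos; have [P [e [uP e0 eZ]]] := pdM_diag pA pG.
exact: possqrt_diag_unique eZ XX Xpos.
Qed.

(** Here [S] stands for the square root of [A], [T] for its inverse and [S K S] for the geometric
    mean. Since [A^-1 = T T], the middle collapses to [S K K S], which is [S T B T S]. *)
Lemma riccati_solution S T K A B : S *m S = A -> S *m T = 1%:M ->
  K *m K = T *m B *m T -> S *m K *m S *m invmx A *m (S *m K *m S) = B.
Proof.
move=> SS ST KK; have TS := mulmx1C ST.
have -> : invmx A = T *m T.
  by apply: mulmx1_invmx; rewrite -SS mulmxA -(mulmxA S S T) ST mulmx1.
rewrite !mulmxA -(mulmxA _ S T) ST mulmx1 -(mulmxA _ T S) TS mulmx1.
by rewrite -(mulmxA S K K) KK !mulmxA ST mul1mx -mulmxA TS mulmx1.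
Qed.

(** The equation gives [(A G)^2 = A^2], so [A] and [A G] are square roots of the same matrix, both
    with positive eigenvalues, and uniqueness makes them equal. *)
Lemma pd_riccati1 A G : pdmx A -> pdmx G -> G *m A *m G = A -> G = 1%:M.
Proof.
move=> pA pG GAG; have uA := pd_unit pA.
suff AG : A = A *m G by rewrite -(mulKmx uA G) -AG mulVmx.
have p1 : pdmx (1%:M : 'M[C]_n).
  have uU := spectral_unitarymx A.
  by rewrite -(udiagmx_const 1 uU); apply: udiagmx_pd => // j.
apply: possqrt_pdM_unique => //; first by rewrite -mulmxA (mulmxA G) GAG.
by move=> a ea; apply: (pdM_eigenvalue_gt0 pA p1); rewrite mulmx1.
Qed.

(** * The expanded Wasserstein sandwich and Weyl monotonicity *)

Lemma wasserstein_expand (t : C) A G :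
  ((1 - t)%:M + t *: G) *m A *m ((1 - t)%:M + t *: G) =
  (1 - t) ^+ 2 *: A + t ^+ 2 *: (G *m A *m G) + (t * (1 - t)) *: (A *m G + G *m A).
Proof.
rewrite !mulmxDl !mulmxDr !mul_scalar_mx -!scalemxAl -!scalemxAr !mul_mx_scalar.
rewrite !scalerA -!expr2 scalerDr [in RHS]addrAC -!addrA; congr (_ + _).
rewrite (mulrC (1 - t)); congr (_ + _); rewrite addrC; congr (_ + _).
Qed.

(* A dimension count: if the bound failed, the vectors whose U-coordinates are
   supported where c <= e and whose V-coordinates are supported where f < c
   would form a nonzero subspace. *)
Lemma count_ge_le U V e f (c : C) : U \is unitarymx -> V \is unitarymx ->
  c \is Num.real -> (forall j, f j \is Num.real) ->
  (forall x, qform (udiagmx U e) x <= qform (udiagmx V f) x) ->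
  (#|[pred j | (c <= e j)%R]| <= #|[pred j | (c <= f j)%R]|)%N.
Proof.
move=> uU uV rc rf le_ef; rewrite leqNgt; apply/negP => lt_fe.
set P := [pred j | c <= e j] in lt_fe *; set Q := [pred j | c <= f j] in lt_fe *.
(* A kernel vector of [N] has [U]-coordinates supported in [P] and [V]-coordinates vanishing on [Q].
   The number of rows is [n - #|P| + #|Q| < n], so a nonzero one exists. *)
pose N := col_mx (rowsub (@enum_val _ [predC P]) U) (rowsub (@enum_val _ Q) V).
have [x x0 Nx] : exists2 x : 'cV_n, x != 0 & N *m x = 0.
  have : kermx N^T != 0.
    rewrite kermx_eq0 /row_free mxrank_tr; apply: contraTneq lt_fe => rN.
    have := rank_leq_row N; rewrite rN -{1}(card_ord n) -(cardC P) addnC.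
    by rewrite leq_add2l -leqNgt.
  move=> /rowV0Pn[v /sub_kermxP vN v0]; exists v^T.
    by apply: contraNneq v0 => /(congr1 trmx); rewrite trmxK trmx0 => ->.
  by apply: trmx_inj; rewrite trmx_mul trmxK vN trmx0.
move/eqP: Nx; rewrite mul_col_mx col_mx_eq0 !mul_rowsub_mx => /andP[/eqP NU /eqP NV].
have xU j : j \notin P -> (U *m x) j 0 = 0.
  move=> jP; have jP' : j \in [predC P] by [].
  have /colP/(_ (enum_rank_in jP' j)) := NU.
  by rewrite !mxE enum_rankK_in.
have xV j : j \in Q -> (V *m x) j 0 = 0.
  move=> jQ; have /colP/(_ (enum_rank_in jQ j)) := NV.
  by rewrite !mxE enum_rankK_in.
have : 0 <= qform (udiagmx U (fun j => e j - c)) x.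
  rewrite qform_udiagmx sumr_ge0// => j _.
  have [jP|/xU->] := boolP (j \in P); last by rewrite normr0 expr0n mulr0.
  by rewrite mulr_ge0 ?exprn_ge0// subr_ge0.
have : 0 < qform (udiagmx V (fun j => c - f j)) x.
  (* The coordinates in [Q] vanish at [x], so their weights may be replaced by 1. All weights are
     then positive and [udiagmx_pd] gives strictness. *)
  rewrite (_ : qform _ x = qform (udiagmx V (fun j => if j \in Q then 1 else c - f j)) x).
    apply: (proj2 (udiagmx_pd uV _)) => // j; case: ifPn => // jQ.
    by rewrite subr_gt0 real_ltNge.
  rewrite !qform_udiagmx; apply: eq_bigr => j _; case: ifPn => // /xV ->.
  by rewrite normr0 expr0n !mulr0.
(* A constant diagonal is the scalar matrix [c%:M] in either basis, so the two bounds share the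
   middle term [qform c%:M x] and contradict [le_ef]. *)
rewrite -!udiagmxB !udiagmx_const// !qformB subr_gt0 subr_ge0 => h1 h2.
by have := le_lt_trans (le_trans h2 (le_ef x)) h1; rewrite ltxx.
Qed.

(* X A X and S X^2 S are similar when A = S^2, and the latter is monotone in
   X^2. *)
Lemma weyl_sandwich A U e f : pdmx A -> U \is unitarymx ->
  (forall j, 0 < e j) -> (forall j, e j <= f j) ->
  exists (h k : 'I_n -> C),
    [/\ (forall j, h j \is Num.real) /\ (forall j, k j \is Num.real),
        char_poly (udiagmx U e *m A *m udiagmx U e) = \prod_j ('X - (h j)%:P),
        char_poly (udiagmx U f *m A *m udiagmx U f) = \prod_j ('X - (k j)%:P),
        forall c, c \is Num.real ->
          (#|[pred j | (c <= h j)%R]| <= #|[pred j | (c <= k j)%R]|)%N &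
        \sum_j h j = \sum_j k j -> e =1 f].
Proof.
move=> pA uU e0 ef; have f0 j : 0 < f j := lt_le_trans (e0 j) (ef j).
have [S pS SS] := pd_sqrt pA.
have sim g : (forall j, 0 < g j) -> char_poly (udiagmx U g *m A *m udiagmx U g) =
    char_poly (S *m udiagmx U (fun j => g j * g j) *m S).
  move=> g0; rewrite -udiagmxM// -SS; set X := udiagmx U g.
  have uXS : X *m S \in unitmx.
    by rewrite unitmx_mul !pd_unit//; exact: udiagmx_pd.
  by have := char_poly_mulmxC (S *m X) uXS; rewrite !mulmxA.
have pdS g : (forall j, 0 < g j) -> pdmx (S *m udiagmx U (fun j => g j * g j) *m S).
  by move=> g0; apply: pd_sandwich => //; apply: udiagmx_pd => // j; rewrite mulr_gt0.
have [V [h [uV h0 Eh _]]] := pd_udiagmx (pdS e e0).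
have [W [k [uW k0 Ek _]]] := pd_udiagmx (pdS f f0).
exists h, k; split.
- by split=> j; exact/gtr0_real.
- by rewrite sim// Eh char_poly_udiagmx.
- by rewrite sim// Ek char_poly_udiagmx.
- move=> c rc; apply: (@count_ge_le V W) => // [j|x]; first exact/gtr0_real.
  rewrite -Eh -Ek -{1 3}(pd_trC pS) !(qform_conj S) -subr_ge0 -qformB udiagmxB.
  by apply: qform_udiagmx_ge0 => j; rewrite subr_ge0 ler_pM// ltW.
rewrite -(mxtrace_udiagmx h uV) -(mxtrace_udiagmx k uW) -Eh -Ek => /esym/eqP.
have trS M : \tr (S *m M *m S) = \tr (M *m A).
  by rewrite mxtrace_mulC mulmxA SS mxtrace_mulC.
rewrite !trS -subr_eq0 -linearB/= -mulmxBl udiagmxB mxtrace_udiagmxM => /eqP tr0 j.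
have B0 i : 0 < (U *m A *m U^t*) i i.
  have := pd_diag_gt0 i (pd_conj (unitary_trC_unit uU) pA).
  by rewrite trmxCK.
move: tr0 => /psumr_eq0P H.
have /eqP : (f j * f j - e j * e j) * (U *m A *m U^t*) j j = 0.
  by apply: H => // i _; rewrite mulr_ge0 ?subr_ge0 ?ler_pM// ltW.
rewrite mulf_eq0 (gt_eqF (B0 j)) orbF -!expr2 subr_eq0.
by rewrite eqrXn2 ?ltW// => /eqP.
Qed.

End Hermitian.

(** * Real powers, the geometric mean and sorted eigenvalues *)

Lemma powR_halfM (R : realType) (a : R) : 0 < a -> powR a 2^-1 * powR a 2^-1 = a.
Proof.
move=> a0; rewrite -powRD; last by rewrite (gt_eqF a0) implybT.
have -> : 2^-1 + 2^-1 = 1 :> R by lra.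
by rewrite powRr1// ltW.
Qed.

Section PosDef.
Variables (R : realType) (n : nat).
Implicit Types (A B G : 'M[R[i]]_n) (e : 'I_n -> R[i]).

Lemma mxpowR_fun A (s : R) :
  mxpowR A s = mxfun (fun z => (powR (complex.Re z) s)%:C) A.
Proof. by []. Qed.

Lemma posdef_pd A : posdefmx A -> pdmx A.
Proof. by []. Qed.

Lemma pd_powR A : pdmx A -> exists U (a : 'I_n -> R),
  [/\ U \is unitarymx, forall j, 0 < a j, A = udiagmx U (fun j => (a j)%:C) &
    forall s, mxpowR A s = udiagmx U (fun j => (powR (a j) s)%:C)].
Proof.
move=> pA; have [U [e [uU e0 -> eg]]] := pd_udiagmx pA.
have eRe j : (complex.Re (e j))%:C = e j by rewrite RRe_real// gtr0_real.
exists U, (fun j => complex.Re (e j)); split.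
- exact: uU.
- by move=> j; rewrite -ltcR eRe.
- by apply: eq_udiagmx => j; rewrite eRe.
- by move=> r; rewrite mxpowR_fun eg.
Qed.

Lemma mxpowR_pd A (s : R) : pdmx A -> pdmx (mxpowR A s).
Proof.
move=> /pd_powR[U [a [uU a0 _ ->]]].
by apply: (udiagmx_pd uU) => j; rewrite ltcR powR_gt0.
Qed.

Lemma mxpowR_halfM A : pdmx A -> mxpowR A 2^-1 *m mxpowR A 2^-1 = A.
Proof.
move=> /pd_powR[U [a [uU a0 eA eP]]].
rewrite eP (udiagmxM _ _ uU) [RHS]eA; apply: eq_udiagmx => j.
by rewrite -rmorphM/= powR_halfM.
Qed.

Lemma mxpowR_half_inv A : pdmx A -> mxpowR A 2^-1 *m mxpowR A (- 2^-1) = 1%:M.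
Proof.
move=> /pd_powR[U [a [uU a0 _ eP]]].
rewrite !eP (udiagmxM _ _ uU) -(udiagmx_const 1 uU); apply: eq_udiagmx => j.
by rewrite -rmorphM/= powRN divff// gt_eqF// powR_gt0.
Qed.

(** Meant for [invmx A] in place of [A], where the equation becomes [G *m A *m G = B]. *)
Lemma geomean_pd_riccati A B : pdmx A -> pdmx B ->
  pdmx (geomean A B) /\ geomean A B *m invmx A *m geomean A B = B.
Proof.
move=> pA pB; have pM := pd_sandwich (mxpowR_pd (- 2^-1) pA) pB.
split.
  exact: (pd_sandwich (mxpowR_pd 2^-1 pA) (mxpowR_pd 2^-1 pM)).
exact: (riccati_solution (mxpowR_halfM pA) (mxpowR_half_inv pA) (mxpowR_halfM pM)).
Qed.

(** Factorization into monic linear factors is unique up to order, and sorting forgets the order, so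
    any listing of the roots computes [lambda]. *)
Lemma lambda_char_poly (M : 'M[R[i]]_n) e (i : 'I_n) :
  char_poly M = \prod_j ('X - (e j)%:P) ->
  lambda M i = nth 0 (sort >=%R [seq complex.Re (e j) | j <- index_enum 'I_n]) i.
Proof.
move=> eM; rewrite /lambda.
have : perm_eq (eigenvalues M) [seq e j | j <- index_enum 'I_n].
  rewrite /eigenvalues; case: closed_field_poly_normal => s /= es.
  apply: prod_XsubC_eq; move: es; rewrite (monicP (char_poly_monic _)) scale1r => <-.
  by rewrite eM big_map.
move=> /(perm_map (@complex.Re R)); rewrite -map_comp => h.
congr nth; apply/perm_sortP => //.
- by move=> x y; exact: le_total.
- by move=> y x z yx zy; exact: le_trans zy yx.
- by move=> x y /andP[xy yx]; apply/le_anti/andP.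
Qed.

Lemma sum_lambda (M : 'M[R[i]]_n) e :
  char_poly M = \prod_j ('X - (e j)%:P) ->
  \sum_i lambda M i = \sum_j complex.Re (e j).
Proof.
move=> eM; set s := [seq complex.Re (e j) | j <- index_enum 'I_n].
have sz : size (sort >=%R s) = n.
  by rewrite size_sort size_map -[index_enum _]enumT size_enum_ord.
transitivity (\sum_(x <- s) x); last by rewrite big_map.
rewrite -(perm_big _ (permEl (perm_sort >=%R s))) /= (big_nth 0) sz big_mkord.
by apply: eq_bigr => i _; exact: lambda_char_poly.
Qed.

Lemma le_lambda_count (M N : 'M[R[i]]_n) (h k : 'I_n -> R[i]) :
  (forall j, h j \is Num.real) -> (forall j, k j \is Num.real) ->
  char_poly M = \prod_j ('X - (h j)%:P) -> char_poly N = \prod_j ('X - (k j)%:P) ->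
  (forall c, c \is Num.real ->
    (#|[pred j | (c <= h j)%R]| <= #|[pred j | (c <= k j)%R]|)%N) ->
  le_lambda M N.
Proof.
move=> rh rk ch ck le_hk i; rewrite (lambda_char_poly i ch) (lambda_char_poly i ck).
apply: nth_sort_ge_le => [||c].
- by rewrite !size_map.
- by rewrite size_map -[index_enum _]enumT size_enum_ord.
have cnt (e : 'I_n -> R[i]) : (forall j, e j \is Num.real) ->
    count (fun z => (c <= z)%R) [seq complex.Re (e j) | j <- index_enum 'I_n] =
    #|[pred j | (c%:C <= e j)%R]|.
  move=> re; rewrite -sum1_count big_map -sum1_card; apply: eq_bigl => j /=.
  by rewrite inE -lecR RRe_real.
by rewrite !cnt//; apply: le_hk; rewrite complex_real.
Qed.

(** Sorting does not change a sum; this reduces equality of all eigenvalues to the trace condition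
    in [weyl_sandwich]. *)
Lemma eq_lambda_sum (M N : 'M[R[i]]_n) (h k : 'I_n -> R[i]) :
  (forall j, h j \is Num.real) -> (forall j, k j \is Num.real) ->
  char_poly M = \prod_j ('X - (h j)%:P) -> char_poly N = \prod_j ('X - (k j)%:P) ->
  (forall i, lambda M i = lambda N i) -> \sum_j h j = \sum_j k j.
Proof.
move=> rh rk ch ck eq_lam.
have hRe (e : 'I_n -> R[i]) : (forall j, e j \is Num.real) ->
    \sum_j e j = (\sum_j complex.Re (e j))%:C.
  by move=> re; rewrite rmorph_sum; apply: eq_bigr => l _; rewrite /= RRe_real.
rewrite (hRe h rh) (hRe k rk); apply: (congr1 (real_complex R)).
by rewrite -(sum_lambda ch) -(sum_lambda ck); apply: eq_bigr => l _.
Qed.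

(** * The Wasserstein mean in factored form *)

Lemma possqrtmx_pdM A G : pdmx A -> pdmx G ->
  possqrtmx (A *m G *m (A *m G)) = A *m G.
Proof.
(* The default value 0 of [xget] is never taken, because [A *m G] itself satisfies the defining
   conditions. *)
move=> pA pG; rewrite /possqrtmx; case: xgetP => [X _ [XX Xpos]|/(_ (A *m G))].
  exact: possqrt_pdM_unique.
by case; split=> // a; exact: pdM_eigenvalue_gt0.
Qed.

(** Since [A B = (A G)^2] and [B A = (G A)^2], the two positive square roots are [A G] and [G A],
    and the sum is an expanded sandwich. *)
Lemma wassersteinmeanE (t : R) A B G : pdmx A -> pdmx G -> G *m A *m G = B ->
  wassersteinmean t A B =
  ((1 - t%:C)%:M + t%:C *: G) *m A *m ((1 - t%:C)%:M + t%:C *: G).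
Proof.
move=> pA pG GAG; rewrite wasserstein_expand GAG /wassersteinmean.
have -> : A *m B = A *m G *m (A *m G) by rewrite -GAG !mulmxA.
have -> : B *m A = G *m A *m (G *m A) by rewrite -GAG !mulmxA.
by rewrite (possqrtmx_pdM pA pG) (possqrtmx_pdM pG pA) !(rmorphXn, rmorphM, rmorphB, rmorph1).
Qed.

End PosDef.

(* Weighted sum of ln z < z - 1 at z = g / u and z = 1 / u, with u the right-hand
   side. *)
Lemma powR_lt_affine (R : realType) (t g : R) : 0 < t -> t < 1 -> 0 < g -> g != 1 ->
  powR g t < 1 - t + t * g.
Proof.
move=> t0 t1 g0 g1; set u := 1 - t + t * g.
have u0 : 0 < u by rewrite /u addr_gt0 ?mulr_gt0// subr_gt0.
have u1 : u != 1.
  apply: contra g1 => /eqP e; rewrite -subr_eq0.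
  have : t * (g - 1) == 0 by apply/eqP; move: e; rewrite /u; lra.
  by rewrite mulf_eq0 gt_eqF.
have lnlt (x : R) : 0 < x -> x != 1 -> ln x < x - 1.
  move=> x0 x1; rewrite ltrBrDl -{2}(lnK (x0 : x \is Num.pos)).
  by apply: expR_gt1Dx; rewrite ln_eq0.
have lnle (x : R) : 0 < x -> ln x <= x - 1.
  by move=> x0; have [->|x1] := eqVneq x 1; rewrite ?ln1 ?subrr// ltW// lnlt.
rewrite /powR gt_eqF// -[X in _ < X](lnK (u0 : u \is Num.pos)) ltr_expR.
(* The strict inequality is taken at [1 / u], with [u != 1] inherited from [g != 1]; the weak one is
   enough at [g / u]. *)
have h1 := lnle _ (divr_gt0 g0 u0).
have h2 : ln u^-1 < u^-1 - 1 by apply: lnlt; rewrite ?invr_gt0// invr_eq1.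
move: h1 h2; rewrite ln_div ?posrE// lnV ?posrE// => h1 h2.
(* The two points average to 1 with weights [t] and [1 - t], so the weighted right-hand sides of
   [h1] and [h2] add up to 0, leaving [t * ln g < ln u]. *)
have h : t * (g / u) + (1 - t) * u^-1 = 1.
  by rewrite mulrA -mulrDl addrC divff// gt_eqF.
have h3 : t * (ln g - ln u) <= t * (g / u - 1) by rewrite ler_pM2l.
have h4 : (1 - t) * (- ln u) < (1 - t) * (u^-1 - 1) by rewrite ltr_pM2l// subr_gt0.
by move: h h3 h4; nra.
Qed.

Theorem corollary3p3 (R : realType) (n : nat) (A B : 'M[R[i]]_n)
    (hA : posdefmx A) (hB : posdefmx B) (t : R) (ht0 : 0 < t) (ht1 : t < 1) :
  le_lambda (specgeomean t A B) (wassersteinmean t A B) /\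
  ((forall i : 'I_n,
      lambda (specgeomean t A B) i = lambda (wassersteinmean t A B) i)
   <-> A = B).
Proof.
have pA := posdef_pd hA; have pB := posdef_pd hB.
have [pG] := geomean_pd_riccati (pd_inv pA) pB.
rewrite /specgeomean; set G := geomean (invmx A) B in pG *; rewrite invmxK => GAG.
rewrite (wassersteinmeanE t pA pG GAG).
have [U [g [uU g0 eG eP]]] := pd_powR pG.
(* The eigenvalues of the two outer factors, [G^t] and [(1 - t) I + t G], in the common basis
   [U]. *)
pose x j := powR (g j) t; pose y j := 1 - t + t * g j.
have -> : mxpowR G t = udiagmx U (fun j => (x j)%:C) by exact: eP.
have -> : (1 - t%:C)%:M + t%:C *: G = udiagmx U (fun j => (y j)%:C).
  rewrite eG udiagmxZ -(udiagmx_const _ uU) udiagmxD; apply: eq_udiagmx => j.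
  by rewrite /y rmorphD rmorphB rmorphM.
have x0 j : 0 < (x j)%:C by rewrite ltcR powR_gt0.
have xy j : (x j)%:C <= (y j)%:C.
  rewrite lecR /x /y; have [->|g1] := eqVneq (g j) 1; last exact/ltW/powR_lt_affine.
  by rewrite powR1 mulr1 subrK.
have [h [k [[rh rk] ch ck le_hk eq_hk]]] := weyl_sandwich pA uU x0 xy.
split; first exact: le_lambda_count ch ck le_hk.
split=> [eq_lam|AB]; last first.
  (* For [A = B] the Riccati equation reads [G A G = A], which forces [G = I]; then [x] and [y] are
     both constantly 1. *)
  have G1 : G = 1%:M by apply: (pd_riccati1 pA pG); rewrite GAG.
  have g1 j : g j = 1.
    have /(udiagmx_inj uU)/(_ j) : udiagmx U (fun j => (g j)%:C) = udiagmx U (fun=> 1).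
      by rewrite -eG G1 udiagmx_const.
    by case.
  have xy1 : (fun j => (x j)%:C) =1 (fun j => (y j)%:C).
    by move=> j; rewrite /x /y g1 powR1 mulr1 subrK.
  by move=> i; rewrite (eq_udiagmx U xy1).
(* The equality clause of [weyl_sandwich] gives [x = y]; strict AM-GM then excludes every
   [g j != 1]. *)
have xyE : x =1 y.
  by move=> j; have [] := eq_hk (eq_lambda_sum rh rk ch ck eq_lam) j.
have G1 : G = 1%:M.
  rewrite eG -(udiagmx_const 1 uU); apply: eq_udiagmx => j.
  have [->//|g1] := eqVneq (g j) 1.
  by have := powR_lt_affine ht0 ht1 (g0 j) g1; rewrite -/(x j) xyE ltxx.
by rewrite -GAG G1 mul1mx mulmx1.
Qed.
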